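(* Let $\mathcal{M}$ be an $\mathbb{A}$-submodule of $\mathbb{A}^K$, $a_1,\dots,a_K\in\mathbb{Z}^n$, and $I,J\subseteq\{1,\dots,K\}$. There exists $\boldsymbol f\in\mathcal{M}\cap(\mathbb{A}^+)^K$ satisfying $$(O_v\cup J)\cap M_v(I,\boldsymbol f)\neq\emptyset\quad\text{for every }v\in\mathbb{R}^n\setminus\{0\}$$ if and only if both of the following hold: (LocR) for every $r\in\mathbb{R}_{>0}^n$ there exists $\boldsymbol f_r\in\mathcal{M}$ with $\boldsymbol f_r(r)\in\mathbb{R}_{>0}^K$; (LocInf) for every $v\in\mathbb{R}^n\setminus\{0\}$ there exists $\boldsymbol f_v\in\mathcal{M}$ such that (a) $\mathrm{in}_v(\boldsymbol f_v)\in(\mathbb{A}^+)^K$, and (b) writing $I'=M_v(I,\boldsymbol f_v)$ and $J'=O_v\cup J$, we have $(O_w\cup J')\cap M_w(I',\mathrm{in}_v(\boldsymbol f_v))\neq\emptyset$ for every $w\in\mathbb{R}^n\setminus\{0\}$.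
   Context: $\mathbb{A}=\mathbb{R}[X_1^{\pm1},\dots,X_n^{\pm1}]$, $\mathbb{A}^+=\mathbb{R}_{\ge0}[X_1^{\pm1},\dots,X_n^{\pm1}]\setminus\{0\}$ (nonzero Laurent polynomials with nonnegative coefficients); $X^b=X_1^{b_1}\cdots X_n^{b_n}$. For $f=\sum c_bX^b\ne0$ and $v\in\mathbb{R}^n\setminus\{0\}$: $\deg_v(f)=\max\{v\cdot b:c_b\ne0\}$, $\deg_v(0)=-\infty$, and $\mathrm{in}_v(f)=\sum_{v\cdot b=\deg_v(f)}c_bX^b$ (with $\mathrm{in}_v(0)=0$), applied componentwise to vectors. $M_v(I,\boldsymbol f)=\{i\in I:\deg_v(f_i)=\max_{i'\in I}\deg_v(f_{i'})\}$; $O_v=\{i\in\{1,\dots,K\}:a_i\not\perp v\}$. $\boldsymbol f(r)$ denotes componentwise evaluation. *)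

(* Defs.v *)
(* Laurent polynomials over a real field R are represented
   by the monoid-algebra carrier {malg R[Z^n]} of multinomials (finitely
   supported coefficient functions 'rV[int]_n -> R), with the multiplication
   defined explicitly below (monalg's own ring structure needs a monoid with
   no nontrivial units, which Z^n is not). *)
From HB Require Import structures.
From mathcomp Require Import all_boot all_order all_algebra.
From mathcomp Require Import finmap.
From mathcomp.multinomials Require Import monalg.
From mathcomp Require Import reals constructive_ereal.

Set Implicit Arguments.
Unset Strict Implicit.
Unset Printing Implicit Defensive.

Import Order.TTheory GRing.Theory Num.Theory.
Local Open Scope ring_scope.


Section Laurent.
Variables (R : realType) (n : nat).

Definition expo := 'rV[int]_n.

Definition laurent := {malg R[expo]}.

Definition lcoef (f : laurent) (b : expo) : R := f@_b.

Definition lmul (f g : laurent) : laurent :=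
  \sum_(a <- msupp f) \sum_(b <- msupp g) << f@_a * g@_b *g (a + b) >>.

Definition dotv (v : 'rV[R]_n) (b : expo) : R :=
  \sum_(j < n) v 0 j * (b 0 j)%:~R.

Definition degv (v : 'rV[R]_n) (f : laurent) : \bar R :=
  \big[Order.max/-oo%E]_(b <- msupp f) (dotv v b)%:E.

Definition inv_ (v : 'rV[R]_n) (f : laurent) : laurent :=
  [malg b in msupp f => if (dotv v b)%:E == degv v f then f@_b else 0].

(* evaluation at r in R^n (with r_j > 0 where used) *)
Definition leval (r : 'rV[R]_n) (f : laurent) : R :=
  \sum_(b <- msupp f) f@_b * \prod_(j < n) (r 0 j) ^ (b 0 j).

Definition Apos (f : laurent) : Prop :=
  f != 0 /\ forall b : expo, 0 <= f@_b.

End Laurent.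

Section Vectors.
Variables (R : realType) (n K : nat).

Definition lvec := {ffun 'I_K -> laurent R n}.

Definition is_submodule (M : lvec -> Prop) : Prop :=
  [/\ M [ffun => 0],
      (forall f g, M f -> M g -> M [ffun i => f i + g i]) &
      (forall (c : laurent R n) f, M f -> M [ffun i => lmul c (f i)])].

Definition inv_vec (v : 'rV[R]_n) (f : lvec) : lvec :=
  [ffun i => inv_ v (f i)].

Definition Mv (v : 'rV[R]_n) (I : {set 'I_K}) (f : lvec) : {set 'I_K} :=
  [set i in I | degv v (f i) ==
                \big[Order.max/-oo%E]_(i' in I) degv v (f i')].

Definition Ov (a : 'I_K -> expo n) (v : 'rV[R]_n) : {set 'I_K} :=
  [set i | dotv v (a i) != 0].

End Vectors.

(* Main.v *)
(* Call a vector f of M good in direction w if its w-initial parts are positive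
   and the index condition holds at w.  Goodness of in_v(f) in all directions
   makes f good in all directions near v, so by compactness finitely many vectors
   are good on open sets covering the unit sphere; summing X^b f_(b) over the
   lattice points b of a large Euclidean ball, with f_(b) good near the direction
   b, yields f1 in M good in every direction, because the ball is strictly convex.

   Positivity of all coefficients is obtained by summing Gaussian multiples
   exp(-t |b|^2) X^b of f1 (for 2tb far from the origin) and of the vectors given
   by (LocR) (for 2tb bounded), with continuous cutoffs.  Since
   exp(-t |b - s|^2) = exp(-t |b|^2) exp(x.s) exp(-t |s|^2) with x = 2tb, the
   coefficient at b is, up to a positive factor and as t -> 0, the value at the
   point exp(x) of the cutoff combination: positive by compactness for bounded x.
   For large x the positive coefficients of f1 dominate the negative ones, also
   where the sum is truncated to a ball: replacing s by an s' with larger x.s'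
   keeps b - s' inside the ball. *)
Require Import Defs.
From HB Require Import structures.
From mathcomp Require Import all_boot all_order all_algebra.
From mathcomp Require Import finmap lra ring zify.
From mathcomp.multinomials Require Import monalg.
From mathcomp Require Import boolp classical_sets filter reals.
From mathcomp Require Import constructive_ereal topology normedtype sequences exp.
(* [classical_sets] shadows [set0] of [finset]. *)
From mathcomp Require Import finset.
Import Order.TTheory GRing.Theory Num.Theory.
Import numFieldNormedType.Exports.
Local Open Scope ring_scope.

Set Implicit Arguments.
Unset Strict Implicit.
Unset Printing Implicit Defensive.

(** * Bilinearity of the pairing between directions and exponents *)

Section Dot.
Variables (R : realType) (n : nat).
Implicit Types (v w x : 'rV[R]_n) (b c s : expo n).

Lemma dotvDl v w b : dotv (v + w) b = dotv v b + dotv w b.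
Proof. by rewrite /dotv -big_split; apply: eq_bigr => j _; rewrite mxE mulrDl. Qed.

Lemma dotvZl (k : R) v b : dotv (k *: v) b = k * dotv v b.
Proof. by rewrite /dotv mulr_sumr; apply: eq_bigr => j _; rewrite mxE mulrA. Qed.

Lemma dotvDr v b c : dotv v (b + c) = dotv v b + dotv v c.
Proof.
by rewrite /dotv -big_split; apply: eq_bigr => j _; rewrite mxE intrD mulrDr.
Qed.

Lemma dotvNr v b : dotv v (- b) = - dotv v b.
Proof.
by rewrite /dotv -sumrN; apply: eq_bigr => j _; rewrite mxE mulrNz mulrN.
Qed.

End Dot.

Lemma seq_argmax (R : realType) (T : eqType) (s : seq T) (g : T -> R) (x0 : T) :
  x0 \in s -> exists2 x, x \in s & forall y, y \in s -> g y <= g x.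
Proof.
elim: s x0 => // z s IH x0 _; case: s IH => [_|z' s IH].
  by exists z; rewrite ?inE // => y; rewrite inE => /eqP->.
have [x xs Hx] := IH z' (mem_head _ _).
case: (leP (g x) (g z)) => xz.
  exists z; rewrite ?mem_head // => y; rewrite inE => /predU1P[->//|/Hx h].
  exact: le_trans xz.
exists x; first by rewrite inE xs orbT.
by move=> y; rewrite inE => /predU1P[->|/Hx//]; exact: ltW.
Qed.

Lemma psum_seq_gt0 (R : realType) (X : eqType) (l : seq X) (F : X -> R) :
  (forall i, i \in l -> 0 <= F i) -> (exists2 i, i \in l & 0 < F i) ->
  0 < \sum_(i <- l) F i.
Proof.
move=> F0 [i il Fi]; rewrite (perm_big _ (perm_to_rem il)) /= big_cons ltr_wpDr //.
by rewrite big_seq sumr_ge0 // => j /mem_rem; exact: F0.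
Qed.

(** * Initial forms through their supports *)

Section Initial.
Variables (R : realType) (n : nat).
Implicit Types (v w : 'rV[R]_n) (f : laurent R n) (b s : expo n).

Lemma msupp_ex f : f != 0 -> exists b, b \in msupp f.
Proof.
move=> f0; have [s0|[b bf]] := fset_0Vmem (msupp f); last by exists b.
case/eqP: f0; apply/malgP => k; rewrite mcoeff0; apply/eqP.
by rewrite mcoeff_eq0 s0.
Qed.

Lemma msupp_neq0 f b : b \in msupp f -> f != 0.
Proof. by rewrite -mcoeff_neq0; apply: contra_neq => ->; rewrite mcoeff0. Qed.

(** Exponents attaining the degree, described by real inequalities only. A nonzero [f] has one,
    which replaces computations with [degv] in the extended reals. *)
Definition vtop v f b :=
  (b \in msupp f) && all (fun b' => dotv v b' <= dotv v b) (msupp f).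

Lemma vtopP v f b : reflect
  (b \in msupp f /\ forall b', b' \in msupp f -> dotv v b' <= dotv v b)
  (vtop v f b).
Proof. by apply: (iffP andP) => -[? /allP]. Qed.

Lemma vtop_ex v f : f != 0 -> exists b, vtop v f b.
Proof.
by move=> /msupp_ex[b0 /(seq_argmax (dotv v))[b bf hb]]; exists b; apply/vtopP.
Qed.

Lemma vtop_degv v f b : vtop v f b -> degv v f = (dotv v b)%:E.
Proof.
case/vtopP => bf hb; apply/eqP; rewrite eq_le; apply/andP; split.
  rewrite /degv big_seq; elim/big_ind: _ => [|x y hx hy|b' /hb].
  - exact: leNye.
  - by rewrite ge_max hx.
  - by rewrite lee_fin.
by rewrite /degv (big_fsetD1 b) //= le_max lexx.
Qed.

Lemma vtop_degvE v f b : b \in msupp f ->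
  ((dotv v b)%:E == degv v f) = vtop v f b.
Proof.
move=> bf; have [t tt] := vtop_ex v (msupp_neq0 bf).
rewrite (vtop_degv tt) eqe; case/vtopP: tt => tf ht.
apply/eqP/vtopP => [->|[_ h]]; first by split.
by apply/eqP; rewrite eq_le ht// h.
Qed.

Lemma inv_coef v f b : (inv_ v f)@_b = if vtop v f b then f@_b else 0.
Proof.
rewrite /inv_ mcoeffE; case: ifP => bf; first by rewrite vtop_degvE.
by rewrite /vtop bf.
Qed.

Lemma msupp_inv v f b : (b \in msupp (inv_ v f)) = vtop v f b.
Proof.
rewrite -mcoeff_neq0 inv_coef; case: ifP => [/vtopP[]|]; rewrite ?eqxx //.
by rewrite -mcoeff_neq0 => ->.
Qed.

Lemma Apos_inv v f : Apos (inv_ v f) <->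
  f != 0 /\ forall b, vtop v f b -> 0 < f@_b.
Proof.
split=> [[/msupp_ex[b]]|[f0 h]].
  rewrite msupp_inv => tb h; split; first by case/vtopP: tb => /msupp_neq0.
  move=> c tc; have := h c; rewrite inv_coef tc le_eqVlt => /predU1P[c0|//].
  by case/vtopP: tc; rewrite -mcoeff_neq0 -c0 eqxx.
split; last by move=> b; rewrite inv_coef; case: ifP => // /h/ltW.
by have [b tb] := vtop_ex v f0; apply: (@msupp_neq0 _ b); rewrite msupp_inv.
Qed.

End Initial.

(** * Goodness in a direction, and its relation to (LocInf) *)

Section Good.
Variables (R : realType) (n K : nat) (a : 'I_K -> expo n) (I J : {set 'I_K}).
Implicit Types (v w : 'rV[R]_n) (f : lvec R n K) (b s : expo n).

Definition vmax v (I' : {set 'I_K}) f b :=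
  forall i' b', i' \in I' -> b' \in msupp (f i') -> dotv v b' <= dotv v b.

(** When all entries are nonzero, every degree is attained at an exponent, so comparing degrees
    amounts to comparing real numbers. A zero entry has degree [-oo] and no exponent to exhibit. *)
Lemma MvP v (I' : {set 'I_K}) f i : (forall i, f i != 0) ->
  i \in Mv v I' f <-> i \in I' /\ exists2 b, b \in msupp (f i) & vmax v I' f b.
Proof.
move=> f0; rewrite inE; split=> [/andP[iI /eqP h]|[iI [b bf hb]]].
  split=> //; have [b tb] := vtop_ex v (f0 i); exists b; first by case/vtopP: tb.
  move=> i' b' i'I b'f.
  rewrite -lee_fin -(vtop_degv tb) h.
  apply: (@le_trans _ _ (degv v (f i'))).
    have [c tc] := vtop_ex v (f0 i'); rewrite (vtop_degv tc) lee_fin.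
    by case/vtopP: tc => _; exact.
  exact: (le_bigmax_cond _ (fun i => degv v (f i))).
rewrite iI /=; have tb : vtop v (f i) b by apply/vtopP; split=> // b' /hb; exact.
rewrite (vtop_degv tb) eq_le; apply/andP; split.
  by rewrite -(vtop_degv tb); exact: (le_bigmax_cond _ (fun i => degv v (f i))).
elim/big_ind: _ => [|x y hx hy|i' i'I].
- exact: leNye.
- by rewrite ge_max hx.
have [c tc] := vtop_ex v (f0 i'); rewrite (vtop_degv tc) lee_fin.
by apply: hb i'I _; case/vtopP: tc.
Qed.

Definition good f v :=
  [/\ forall i, f i != 0, forall i b, vtop v (f i) b -> 0 < (f i)@_b
    & exists i b, [/\ i \in I, i \in Ov a v :|: J, b \in msupp (f i)
                    & vmax v I f b]].

Lemma goodP f v : good f v <->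
  (forall i, Apos (inv_vec v f i)) /\ (Ov a v :|: J) :&: Mv v I f != set0.
Proof.
split=> [[f0 fp [i [b [iI iJ bf hb]]]]|[h1 /set0Pn[i]]].
  split=> [i'|]; first by rewrite ffunE; apply/Apos_inv; split; [|exact: fp].
  by apply/set0Pn; exists i; rewrite inE iJ; apply/MvP => //; split=> //; exists b.
rewrite inE => /andP[iJ iM].
have f0 i' : f i' != 0 by have := h1 i'; rewrite ffunE => /Apos_inv[].
case/MvP: iM => // iI [b bf hb]; split=> //; last by exists i, b.
by move=> i' b'; have := h1 i'; rewrite ffunE => /Apos_inv[_]; exact.
Qed.

Lemma good_scale f v (k : R) : 0 < k -> good f v -> good f (k *: v).
Proof.
move=> k0 [f0 fp [i [b [iI iJ bf hb]]]]; split=> //.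
  move=> i' b' /vtopP[b'f hb']; apply: fp; apply/vtopP; split=> // c /hb'.
  by rewrite !dotvZl ler_pM2l.
exists i, b; split=> //; last first.
  by move=> i' b' i'I b'f; rewrite !dotvZl ler_pM2l//; exact: (hb i').
by move: iJ; rewrite !inE dotvZl mulf_eq0 (gt_eqF k0).
Qed.

(** The order by [w] on the exponents of [f] only breaks ties of the order by [v], so tops for [w]
    are already tops for [v]. This is the case for all [w] close to [v]. *)
Definition refines v w f := forall i i' b b', b \in msupp (f i) ->
  b' \in msupp (f i') -> dotv v b < dotv v b' -> dotv w b < dotv w b'.

Definition locinf_at f v := [/\ forall i, Apos (inv_vec v f i) &
  forall w, w != 0 -> (Ov a w :|: (Ov a v :|: J)) :&:
     Mv w (Mv v I f) (inv_vec v f) != set0].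

(** By refinement the top exponents for [w] lie in the initial form for [v]. There the pairing with
    [v] is constant, so [w] and [w - v] order them alike and (LocInf) in direction [w - v] gives the
    index condition. *)
Lemma locinf_good f v w : v != 0 -> refines v w f ->
    (forall i, dotv v (a i) != 0 -> dotv w (a i) != 0) ->
  locinf_at f v -> good f w.
Proof.
move=> v0 rf ra [h1 h2].
have f0 i' : f i' != 0 by have := h1 i'; rewrite ffunE => /Apos_inv[].
have fi0 i' : inv_vec v f i' != 0 by case: (h1 i').
have wE : w = v + (w - v) by rewrite addrC subrK.
split=> //.
  move=> i b /vtopP[bf hb].
  have /Apos_inv[_] : Apos (inv_ v (f i)) by have := h1 i; rewrite ffunE.
  apply; apply/vtopP; split=> // b' b'f; rewrite leNgt; apply/negP => bb'.
  by have := rf _ _ _ _ bf b'f bb'; rewrite ltNge hb.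
(* For [w = v] the difference is no admissible direction; (LocInf) is applied to [v] itself, where
   the union of index sets collapses to [Ov a v :|: J]. *)
have [wv|uN0] := eqVneq (w - v) 0.
  move/eqP: wv; rewrite subr_eq0 => /eqP wv; rewrite wv in rf ra wE *.
  have /set0Pn[i] := h2 v v0; rewrite inE setUA setUid => /andP[iJ].
  case/MvP => // iM [b]; rewrite ffunE msupp_inv => tb _.
  case/MvP: iM => // iI [c cf hc]; exists i, b; split=> //.
    by case/vtopP: tb.
  move=> i' b' i'I b'f; apply: le_trans (hc _ _ i'I b'f) _.
  by case/vtopP: tb => _; exact.
have /set0Pn[i] := h2 _ uN0; rewrite inE => /andP[iJ].
case/MvP => // iM [b]; rewrite ffunE msupp_inv => tb hb.
have [iI [c cf hc]] := (MvP v I i f0).1 iM.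
have bmax : vmax v I f b.
  move=> i' b' i'I b'f; apply: le_trans (hc _ _ i'I b'f) _.
  by case/vtopP: tb => _; exact.
have bf : b \in msupp (f i) by case/vtopP: tb.
exists i, b; split=> //.
  move: iJ; rewrite !inE; case: (i \in J); rewrite ?orbT // !orbF.
  (* If [a i] is orthogonal to [v], its pairings with [w] and [w - v] agree. *)
  case: (eqVneq (dotv v (a i)) 0) => [av|/ra -> //]; rewrite orbF.
  suff -> : dotv w (a i) = dotv (w - v) (a i) by [].
  by rewrite -[in LHS](subrK v w) [LHS]dotvDl av addr0.
move=> i' b' i'I b'f; have := bmax _ _ i'I b'f; rewrite le_eqVlt => /predU1P[e|].
  have b'max : vmax v I f b' by move=> j c'; rewrite e; exact: bmax.
  have i'M : i' \in Mv v I f by apply/MvP => //; split=> //; exists b'.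
  have tb' : vtop v (f i') b' by apply/vtopP; split=> // ? /b'max; exact.
  rewrite wE ![dotv (v + _) _]dotvDl e lerD2l; apply: (hb i') => //.
  by rewrite ffunE msupp_inv.
by move/(rf _ _ _ _ b'f bf)/ltW.
Qed.

(** Converse passage, from the perturbed direction [v + e *: w]: a maximiser there is one for [v] by
    refinement, and maximises [w] among those. A vector [a i] not orthogonal to the perturbed
    direction is not orthogonal to both [v] and [w]. *)
Lemma good_locinf f v w (e : R) : 0 < e -> refines v (v + e *: w) f ->
    (forall i, Apos (inv_vec v f i)) -> good f (v + e *: w) ->
  (Ov a w :|: (Ov a v :|: J)) :&: Mv w (Mv v I f) (inv_vec v f) != set0.
Proof.
move=> e0 rf h1 [f0 fp [i [b [iI iJ bf hb]]]].
have fi0 i' : inv_vec v f i' != 0 by case: (h1 i').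
have bmax : vmax v I f b.
  move=> i' b' i'I b'f; rewrite leNgt; apply/negP => bb'.
  by have := rf _ _ _ _ bf b'f bb'; rewrite ltNge (hb _ _ i'I b'f).
have tb : vtop v (f i) b by apply/vtopP; split=> // ? /bmax; exact.
apply/set0Pn; exists i; rewrite inE; apply/andP; split.
  move: iJ; rewrite !inE dotvDl dotvZl.
  case: (i \in J); rewrite ?orbT // !orbF; apply: contra_neqT.
  by rewrite negb_or !negbK => /andP[/eqP-> /eqP->]; rewrite mulr0 addr0.
apply/MvP => //; split; first by apply/MvP => //; split=> //; exists b.
exists b; first by rewrite ffunE msupp_inv.
move=> i' b' /(MvP _ _ _ f0)[i'I [c cf hc]]; rewrite ffunE msupp_inv => tb'.
have b'f : b' \in msupp (f i') by case/vtopP: tb'.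
have vb : dotv v b' = dotv v b.
  apply/eqP; rewrite eq_le (bmax _ _ i'I b'f) /=; apply: le_trans (hc _ _ iI bf) _.
  by case/vtopP: tb' => _; exact.
by have := hb _ _ i'I b'f; rewrite !dotvDl vb lerD2l !dotvZl ler_pM2l.
Qed.

End Good.

(** * Sums of monomial multiples *)

Section Combination.
Variables (R : realType) (n K : nat).
Implicit Types (f : lvec R n K) (b s t : expo n) (L : seq (R * expo n * lvec R n K)).

Lemma lmul_monomial (c : R) b (f : laurent R n) t :
  (lmul << c *g b >> f)@_t = c * f@_(t - b).
Proof.
rewrite /lmul msuppU; have [->|c0] := eqVneq c 0.
  by rewrite big_seq_fset0 mcoeff0 mul0r.
rewrite big_seq_fset1 raddf_sum /=.
have coefE s : << << c *g b >>@_b * f@_s *g (b + s) >>@_t =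
    c * f@_s *+ (s == t - b).
  by rewrite mcoeffUU mcoeffU [s == _]eq_sym subr_eq [b + s]addrC [t == _]eq_sym.
rewrite (eq_bigr _ (fun s _ => coefE s)).
have [tf|tf] := boolP (t - b \in msupp f).
  rewrite (big_fsetD1 (t - b)) //= eqxx mulr1n big1_fset ?addr0 // => s.
  by rewrite in_fsetD1 => /andP[/negbTE-> _].
rewrite big1_fset => [|s sf _]; first by rewrite (mcoeff_outdom tf) mulr0.
by case: eqP sf => // ->; rewrite (negbTE tf).
Qed.

(** A triple [(c, b, f)] in the list stands for the summand c X^b f. *)
Definition comb L : lvec R n K :=
  [ffun i => \sum_(p <- L) lmul << p.1.1 *g p.1.2 >> (p.2 i)].

Lemma comb_coef L i t :
  (comb L i)@_t = \sum_(p <- L) p.1.1 * (p.2 i)@_(t - p.1.2).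
Proof.
by rewrite ffunE raddf_sum; apply: eq_bigr => p _; exact: lmul_monomial.
Qed.

Lemma comb_submodule (M : lvec R n K -> Prop) L : is_submodule M ->
  (forall p, p \in L -> M p.2) -> M (comb L).
Proof.
case=> M0 MD MM; elim: L => [_|p L IH ML].
  suff -> : comb [::] = [ffun => 0] by [].
  by apply/ffunP => i; rewrite !ffunE big_nil.
suff -> : comb (p :: L) =
    [ffun i => [ffun i => lmul << p.1.1 *g p.1.2 >> (p.2 i)] i + comb L i].
  apply: MD; first by apply: MM; apply: ML; rewrite mem_head.
  by apply: IH => q qL; apply: ML; rewrite inE qL orbT.
by apply/ffunP => i; rewrite !ffunE big_cons.
Qed.

Lemma msupp_comb L i t : t \in msupp (comb L i) ->
  exists2 p, p \in L & t - p.1.2 \in msupp (p.2 i).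
Proof.
rewrite -mcoeff_neq0 comb_coef => h; apply: contrapT => h'.
move/eqP: h; apply; rewrite big_seq big1 // => p pL.
rewrite mcoeff_outdom ?mulr0 //; apply/negP => pf; apply: h'; by exists p.
Qed.

End Combination.

(** * Goodness of a sum whose dominant terms are good *)

Section Glue.
Variables (R : realType) (n K : nat) (a : 'I_K -> expo n) (I J : {set 'I_K}).
Implicit Types (v w : 'rV[R]_n) (f : lvec R n K) (b s t : expo n).
Variables (w : 'rV[R]_n) (L : seq (R * expo n * lvec R n K)).

(** The comparison is with the exponents of the separate terms, before any cancellation. With
    [s = 0] it speaks of the single exponent [b]. *)
Definition dominant i b s := forall p s', p \in L -> s' \in msupp (p.2 i) ->
  dotv w (p.1.2 + s') <= dotv w (b + s).

(** Only vectors good in direction [w] contribute at a dominant exponent, each through a top and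
    hence positive coefficient. So nothing cancels there, and the index condition passes from a term
    dominant over [I] to the sum. *)
Lemma good_comb :
  (forall p, p \in L -> 0 < p.1.1) ->
  (exists2 p, p \in L & good a I J p.2 w) ->
  (forall i p s, p \in L -> s \in msupp (p.2 i) -> dominant i p.1.2 s ->
     good a I J p.2 w) ->
  good a I J (comb L) w.
Proof.
move=> Lpos [p0 p0L [p0nz _ [i0 [b0 [i0I _ b0f _]]]]] dom.
have term_ge0 i p t : p \in L -> dominant i t 0 ->
    0 <= p.1.1 * (p.2 i)@_(t - p.1.2).
  move=> pL tdom; have [sf|sf] := boolP (t - p.1.2 \in msupp (p.2 i)); last first.
    by rewrite (mcoeff_outdom sf) mulr0.
  rewrite mulr_ge0 ?(ltW (Lpos _ pL)) // ltW //.
  have sdom : dominant i p.1.2 (t - p.1.2).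
    by move=> q s' qL s'f; rewrite [p.1.2 + _]addrC subrK -[t]addr0; exact: tdom.
  have [_ + _] := dom _ _ _ pL sf sdom; apply; apply/vtopP; split=> // s' s'f.
  by have := sdom p s' pL s'f; rewrite !dotvDr lerD2l.
have dom_msupp i p s : p \in L -> s \in msupp (p.2 i) -> dominant i p.1.2 s ->
    p.1.2 + s \in msupp (comb L i).
  move=> pL sf sdom; rewrite -mcoeff_neq0 comb_coef gt_eqF //.
  have tdom : dominant i (p.1.2 + s) 0 by move=> q s' qL s'f; rewrite addr0; exact: sdom.
  apply: psum_seq_gt0; first by move=> q qL; exact: term_ge0.
  exists p => //; rewrite addrAC subrr add0r mulr_gt0 ?Lpos //.
  have [_ + _] := dom _ _ _ pL sf sdom; apply; apply/vtopP; split=> // s' s'f.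
  by have := sdom p s' pL s'f; rewrite !dotvDr lerD2l.
have comb_le i b s t : dominant i b s -> t \in msupp (comb L i) ->
    dotv w t <= dotv w (b + s).
  move=> sdom /msupp_comb[q qL tq]; rewrite -[t](subrK q.1.2) addrC; exact: sdom.
(* Used with a singleton for the positivity of one entry, and with [I] for the index condition. *)
have dom_ex (A : {set 'I_K}) i : i \in A -> exists i' p s,
    [/\ i' \in A, p \in L, s \in msupp (p.2 i') &
        forall i'', i'' \in A -> dominant i'' p.1.2 s].
  move=> iA; have [s0 s0f] := msupp_ex (p0nz i).
  pose P (j : 'I_K) := [seq (p, s) | p : R * expo n * lvec R n K <- L,
                                     s : expo n <- msupp (p.2 j)].
  have PP j p s : p \in L -> s \in msupp (p.2 j) -> (p, s) \in P j.
    by move=> pL sf; apply/allpairsPdep; exists p, s.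
  pose T := [seq (j, q) | j <- enum A, q <- P j].
  have TP j q : j \in A -> q \in P j -> (j, q) \in T.
    by move=> jA qP; apply/allpairsPdep; exists j, q; rewrite mem_enum.
  have T0 := TP _ _ iA (PP _ _ _ p0L s0f).
  have [x xT hx] := seq_argmax (fun x => dotv w (x.2.1.1.2 + x.2.2)) T0.
  case/allpairsPdep: xT hx => i' [q [i'A /allpairsPdep[p [s [pL sf ->]]] ->]] hx.
  exists i', p, s; rewrite mem_enum in i'A; split=> // i'' i''A p' s' p'L s'f.
  exact: (hx _ (TP _ _ i''A (PP _ _ _ p'L s'f))).
split.
- move=> i; have [i' [p [s []]]] := dom_ex [set i] i (set11 i).
  rewrite inE => /eqP-> pL sf /(_ i (set11 i)) sdom.
  exact: msupp_neq0 (dom_msupp _ _ _ pL sf sdom).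
- move=> i t /vtopP[tf ht].
  have [i' [p [s []]]] := dom_ex [set i] i (set11 i).
  rewrite inE => /eqP-> pL sf /(_ i (set11 i)) sdom.
  have st := ht _ (dom_msupp _ _ _ pL sf sdom).
  rewrite lt_neqAle eq_sym mcoeff_neq0 tf /= comb_coef big_seq sumr_ge0 // => q qL.
  apply: term_ge0 => // p' s' p'L s'f; rewrite addr0; apply: le_trans st.
  exact: sdom.
- have [i [p [s [iI pL sf sdom]]]] := dom_ex I i0 i0I.
  have [_ _ [i1 [s1 [i1I i1J s1f hs1]]]] := dom _ _ _ pL sf (sdom i iI).
  have s1dom i' : i' \in I -> dominant i' p.1.2 s1.
    move=> i'I q s' qL s'f; apply: le_trans (sdom _ i'I _ _ qL s'f) _.
    by rewrite !dotvDr lerD2l; exact: hs1 iI sf.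
  exists i1, (p.1.2 + s1); split=> //; first exact: dom_msupp (s1dom _ i1I).
  by move=> i' t i'I; apply: comb_le; exact: s1dom.
Qed.

End Glue.

(** * Lattice points in Euclidean balls *)

Section Lattice.
Variables (R : realType) (n : nat).
Implicit Types (b s : expo n) (x y w : 'rV[R]_n).

Definition emb b : 'rV[R]_n := map_mx intr b.

(** The squared Euclidean norm. The norm written with bars is the sup norm, whose balls are not
    strictly convex. *)
Definition sqn x : R := \sum_j x 0 j ^+ 2.

Lemma sqn_ge0 x : 0 <= sqn x.
Proof. by apply: sumr_ge0 => j _; exact: sqr_ge0. Qed.

Lemma sqn_coord x j : x 0 j ^+ 2 <= sqn x.
Proof.
by rewrite /sqn (bigD1 j) //= lerDl; apply: sumr_ge0 => i _; exact: sqr_ge0.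
Qed.

Lemma sqn_subZ x b (k : R) :
  sqn (x - k *: emb b) = sqn x - 2 * k * dotv x b + k ^+ 2 * sqn (emb b).
Proof.
rewrite /sqn /dotv !mulr_sumr -sumrB -big_split; apply: eq_bigr => j _.
by rewrite !mxE /=; ring.
Qed.

Lemma embB b s : emb (b - s) = emb b - emb s.
Proof. exact: raddfB. Qed.

Lemma lattice_ball (N : nat) : exists B : seq (expo n),
  uniq B /\ forall b, (b \in B) = (sqn (emb b) <= N%:R ^+ 2).
Proof.
pose F (g : {ffun 'I_n -> 'I_(N.*2.+1)}) : expo n := \row_j ((g j)%:Z - N%:Z).
pose B0 := undup [seq F g | g : {ffun 'I_n -> 'I_(N.*2.+1)}].
exists [seq b <- B0 | sqn (emb b) <= N%:R ^+ 2]; split.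
  by rewrite filter_uniq // undup_uniq.
move=> b; rewrite mem_filter; apply: andb_idr => hb; rewrite mem_undup.
have bN j : leq (absz (b 0 j)) N.
  have := le_trans (sqn_coord (emb b) j) hb.
  rewrite mxE -real_normK ?num_real // ler_pXn2r ?nnegrE // -intr_norm -abszE.
  by rewrite ler_nat.
apply/mapP; exists [ffun j => inord (absz (b 0 j + N%:Z))]; first by rewrite mem_enum.
apply/rowP => j; rewrite mxE ffunE inordK; have := bN j; move: (b 0 j) => z; lia.
Qed.

(** Rounding each coordinate of N w toward zero does not lengthen the vector, and lowers each of the
    [n] products in the pairing by at most 1. *)
Lemma lattice_approx w (N : nat) : sqn w = 1 ->
  exists b, sqn (emb b) <= N%:R ^+ 2 /\ N%:R - n%:R <= dotv w b.
Proof.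
move=> w1.
pose b : expo n := \row_j (if 0 <= w 0 j then Num.floor (N%:R * w 0 j)
                          else - Num.floor (- (N%:R * w 0 j))).
have w1j j : `|w 0 j| <= 1.
  by have := sqn_coord w j; rewrite w1 -real_normK ?num_real // -[leRHS](expr1n _ 2) ler_pXn2r ?nnegrE.
have bj j : (emb b) 0 j ^+ 2 <= N%:R ^+ 2 * w 0 j ^+ 2 /\
    N%:R * w 0 j ^+ 2 - 1 <= w 0 j * (b 0 j)%:~R.
  rewrite !mxE; set N' : R := N%:R; have N0 : 0 <= N' by [].
  have := w1j j; case: (leP 0 (w 0 j)) => wj.
    rewrite ger0_norm // => wj1; set k := Num.floor _.
    have k0 : (0 : R) <= k%:~R by rewrite ler0z floor_ge0 mulr_ge0.
    have k1 : (k%:~R : R) <= N' * w 0 j by rewrite floor_le.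
    have k2 : N' * w 0 j < k%:~R + 1 by rewrite -[1 in ltRHS](mulr1z 1) -intrD floorD1_gt.
    split; first by rewrite -exprMn ler_pXn2r ?nnegrE ?mulr_ge0.
    nra.
  rewrite ltr0_norm // => wj1; set k := Num.floor _.
  have k0 : (0 : R) <= k%:~R by rewrite ler0z floor_ge0 -mulrN mulr_ge0 // oppr_ge0 ltW.
  have k1 : (k%:~R : R) <= - (N' * w 0 j) by rewrite floor_le.
  have k2 : - (N' * w 0 j) < k%:~R + 1 by rewrite -[1 in ltRHS](mulr1z 1) -intrD floorD1_gt.
  rewrite mulrNz; split; last nra.
  by rewrite sqrrN -exprMn -[leRHS]sqrrN ler_pXn2r ?nnegrE // -mulrN mulr_ge0 // oppr_ge0 ltW.
exists b; split.
  have -> : N%:R ^+ 2 = N%:R ^+ 2 * sqn w by rewrite w1 mulr1.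
  by rewrite mulr_sumr; apply: ler_sum => j _; exact: (bj j).1.
have -> : N%:R - n%:R = \sum_(j < n) (N%:R * w 0 j ^+ 2 - 1).
  by rewrite sumrB -mulr_sumr -/(sqn w) w1 mulr1 sumr_const card_ord.
by apply: ler_sum => j _; exact: (bj j).2.
Qed.

End Lattice.

Local Open Scope classical_set_scope.

(** * Continuity of the pairing and compactness of the unit sphere *)

Section Topology.
Variables (R : realType) (n : nat).
Implicit Types (b s : expo n) (x y v w : 'rV[R]_n).

Lemma filter_seq (T : Type) (F : set_system T) (X : eqType) (l : seq X)
    (P : X -> T -> Prop) : Filter F ->
  (forall i, i \in l -> \forall x \near F, P i x) ->
  \forall x \near F, forall i, i \in l -> P i x.
Proof.
move=> FF; elim: l => [_|j l IH h]; first by apply: filterS filterT.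
apply: filterS2 (h j (mem_head _ _)) (IH _) => [x Pj Pl i|i il].
  by rewrite inE => /predU1P[->//|]; exact: Pl.
by apply: h; rewrite inE il orbT.
Qed.

Lemma seq_bound (X : eqType) (l : seq X) (g : X -> R) :
  exists2 C, 0 <= C & forall i, i \in l -> g i <= C.
Proof.
elim: l => [|j l [C C0 hC]]; first by exists 0.
exists (Num.max C (g j)) => [|i]; first by rewrite le_max C0.
by rewrite inE => /predU1P[->|/hC h]; rewrite le_max ?lexx ?orbT // h.
Qed.

Lemma cvg_sum_seq (T : Type) (F : set_system T) (X : Type) (l : seq X)
    (g : X -> T -> R) (c : X -> R) : Filter F ->
  (forall i, g i x @[x --> F] --> c i) ->
  \sum_(i <- l) g i x @[x --> F] --> \sum_(i <- l) c i.
Proof.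
move=> FF h; apply: (cvg_big (U := R) (op := +%R) (x0 := 0)) => //.
exact: add_continuous.
Qed.

Lemma cvg_dotv (T : Type) (F : set_system T) (g : T -> 'rV[R]_n) v b :
  Filter F -> g @ F --> v -> dotv (g x) b @[x --> F] --> dotv v b.
Proof.
move=> FF gv; apply: cvg_sum_seq => j; apply: cvgM; last exact: cvg_cst.
by apply: (cvg_comp g (fun M : 'rV[R]_n => M 0 j)) gv _; exact: coord_continuous.
Qed.

Lemma dotv_continuous b : continuous (fun v => dotv v b : R^o).
Proof. by move=> v; exact: (@cvg_dotv _ (nbhs v) id v b _ cvg_id). Qed.

Lemma cvg_sqn (T : Type) (F : set_system T) (g : T -> 'rV[R]_n) v :
  Filter F -> g @ F --> v -> sqn (g x) @[x --> F] --> sqn v.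
Proof.
move=> FF gv; apply: cvg_sum_seq => j; rewrite expr2.
under eq_cvg do rewrite expr2.
by apply: cvgM; apply: (cvg_comp g (fun M : 'rV[R]_n => M 0 j)) gv _;
  exact: coord_continuous.
Qed.

Lemma normr_coord x j : `|x 0 j| <= `|x|.
Proof.
rewrite [leRHS]/Num.Def.normr /= mx_normrE.
by apply: (le_bigmax _ (fun ij : 'I_1 * 'I_n => `|x ij.1 ij.2|) (0, j)).
Qed.

Lemma normr_le x (e : R) : 0 <= e -> (forall j, `|x 0 j| <= e) -> `|x| <= e.
Proof.
move=> e0 h; rewrite [leLHS]/Num.Def.normr /= mx_normrE.
by apply: bigmax_le => // -[i j] _ /=; rewrite ord1.
Qed.

Lemma sqn_normr_lt x (e : R) : 0 < e -> sqn x < e ^+ 2 -> `|x| < e.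
Proof.
move=> e0 h; have [x0|/mx_norm_neq0[[i j] xE]] := eqVneq (mx_norm x) 0.
  by rewrite [ltLHS]/Num.Def.normr /= x0.
rewrite [ltLHS]/Num.Def.normr /= xE /= ord1.
rewrite -(ltr_pXn2r (n := 2)) ?nnegrE ?(ltW e0) //.
by rewrite real_normK ?num_real //; apply: le_lt_trans h; exact: sqn_coord.
Qed.

Lemma sqn_gt0 x : x != 0 -> 0 < sqn x.
Proof.
move=> x0; rewrite lt_neqAle sqn_ge0 andbT eq_sym; apply: contra x0 => /eqP x0.
apply/eqP/rowP => j; rewrite mxE; apply/eqP; rewrite -sqrf_eq0.
by rewrite eq_le sqr_ge0 andbT -x0 sqn_coord.
Qed.

Lemma sqnZ (k : R) x : sqn (k *: x) = k ^+ 2 * sqn x.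
Proof. by rewrite /sqn mulr_sumr; apply: eq_bigr => j _; rewrite mxE exprMn. Qed.

Lemma unit_scaling x : x != 0 ->
  exists2 c : R, 0 < c & exists2 u, sqn u = 1 & x = c *: u.
Proof.
move=> /sqn_gt0 x0; exists (Num.sqrt (sqn x)); first by rewrite sqrtr_gt0.
exists ((Num.sqrt (sqn x))^-1 *: x).
  by rewrite sqnZ exprVn sqr_sqrtr ?sqn_ge0 // mulVf // gt_eqF.
by rewrite scalerA mulfV ?scale1r // gt_eqF // sqrtr_gt0.
Qed.

Definition sphere : set 'rV[R]_n := [set w | sqn w = 1].

Lemma sphere_neq0 w : sqn w = 1 -> w != 0.
Proof.
move=> w1; apply/eqP => w0; move: w1; rewrite w0 /sqn big1 => [/eqP|j _].
  by rewrite eq_sym oner_eq0.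
by rewrite mxE expr0n.
Qed.

Lemma sphere_coord w j : sqn w = 1 -> `|w 0 j| <= 1.
Proof.
move=> w1; have := sqn_coord w j.
by rewrite w1 -real_normK ?num_real // -[leRHS](expr1n _ 2) ler_pXn2r ?nnegrE.
Qed.

Lemma sphere_compact : compact sphere.
Proof.
apply: bounded_closed_compact.
  exists 1; split; first exact: num_real.
  move=> M M1 w /= w1; apply: le_trans (ltW M1); apply: normr_le => // j.
  exact: sphere_coord.
have /continuous_closedP : continuous (@sqn R n : 'rV[R]_n -> R^o).
  by move=> x; exact: (@cvg_sqn _ (nbhs x) id x _ cvg_id).
by move=> /(_ _ (@closed_eq _ 1)).
Qed.

Definition l1 s : R := \sum_j `|(s 0 j)%:~R|.

Lemma dotv_sphere_le w s : sqn w = 1 -> `|dotv w s| <= l1 s.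
Proof.
move=> w1; apply: le_trans (ler_norm_sum _ _ _) _; apply: ler_sum => j _.
by rewrite normrM ler_piMl // sphere_coord.
Qed.

End Topology.

(** * From (LocInf) to one vector good in every direction *)

Section Infinity.
Variables (R : realType) (n K : nat) (a : 'I_K -> expo n) (I J : {set 'I_K}).
Implicit Types (v w : 'rV[R]_n) (f : lvec R n K) (b s t : expo n).

Definition expos (l : seq (lvec R n K)) : seq (expo n) :=
  flatten [seq flatten [seq (msupp (f i) : seq (expo n)) | i <- enum 'I_K]
          | f : lvec R n K <- l].

Lemma mem_expos (l : seq (lvec R n K)) f i s :
  f \in l -> s \in msupp (f i) -> s \in expos l.
Proof.
move=> fl sf; apply/flattenP; eexists; first by apply: map_f; exact: fl.
by apply/flattenP; eexists; first by apply: map_f; exact: (mem_enum _ i).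
Qed.

(** Finitely many pairs of exponents occur, and each strict inequality is an open condition on the
    direction. *)
Lemma near_refines v f : \forall w \near v, refines v w f.
Proof.
pose E := expos [:: f].
suff : \forall w \near v, forall b, b \in E -> forall b', b' \in E ->
    dotv v b < dotv v b' -> dotv w b < dotv w b'.
  apply: filterS => w h i i' b b' bf b'f; apply: h.
    exact: mem_expos (mem_head _ _) bf.
  exact: mem_expos (mem_head _ _) b'f.
apply: (@filter_seq _ (nbhs v)) => b _; apply: (@filter_seq _ (nbhs v)) => b' _.
have [bb'|bb'] := boolP (dotv v b < dotv v b'); last by apply: filterS filterT.
have bb'0 : 0 < dotv v (b' - b) by rewrite dotvDr dotvNr subr_gt0.
apply: filterS (cvgr_gt _ (@dotv_continuous R n (b' - b) v) _ bb'0) => w.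
by rewrite dotvDr dotvNr subr_gt0.
Qed.

Lemma near_Ov v :
  \forall w \near v, forall i, dotv v (a i) != 0 -> dotv w (a i) != 0.
Proof.
apply: (@filter_forall _ _ _ (nbhs v)) => i.
have [vi|vi] := eqVneq (dotv v (a i)) 0; first by apply: filterS filterT.
by apply: filterS (cvgr_neq0 _ (@dotv_continuous R n (a i) v) vi).
Qed.

Lemma locinf_near_good f v : v != 0 -> locinf_at a I J f v ->
  \forall w \near v, good a I J f w.
Proof.
move=> v0 h; apply: filterS2 (near_refines v f) (near_Ov v) => w rw ow.
exact: locinf_good rw ow h.
Qed.

(** In direction [w] the dominant exponents come from points [b] of the ball of radius [N] with
    [dotv w b] nearly [N]. For these b / N is close to [w], so the vector attached to [b] is good at
    [w]. *)
Lemma glue_infinity (M : lvec R n K -> Prop) : is_submodule M ->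
  (forall v, v != 0 -> exists f, M f /\ \forall w \near v, good a I J f w) ->
  exists F, M F /\ forall w, w != 0 -> good a I J F w.
Proof.
move=> HM H.
pose U f : set 'rV[R]_n := [set w | good a I J f w]°.
have := @sphere_compact R n; rewrite compact_cover => /(_ _ [set f | M f] U).
case=> [f _|v v1|D' D'M cov]; first exact: open_interior.
  by have [f [Mf gf]] := H v (sphere_neq0 v1); exists f.
have MD f : f \in D' -> M f by move=> /D'M/set_mem.
(* A Lebesgue number of the finite cover. *)
have [d d0 hd] : exists2 d : R, 0 < d & forall w, sqn w = 1 ->
    exists2 f, f \in D' & forall y, `|w - y| < d -> good a I J f y.
  pose Q (d : R) w := exists2 f, f \in D' &
    forall y, `|w - y| < d -> good a I J f y.
  have h : \forall d \near 0^'+, @sphere R n `<=` Q d.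
    have /compact_near_coveringP := @sphere_compact R n; apply => w w1.
    have [f /= fD /nbhs_normP[e /= e0 he]] := cov _ w1.
    have e20 : 0 < e / 2 by rewrite divr_gt0.
    near=> x' d; exists f => // y /= yd; apply: he => /=.
    have de : d < e / 2 by clear yd y; near: d; exact: nbhs_right_lt.
    have xe : `|w - x'| < e / 2.
      by clear yd y; near: x'; apply: (@cvgr_dist_lt _ _ _ (nbhs w) _ id w cvg_id).
    rewrite -(subrK x' w) -addrA (le_lt_trans (ler_normD _ _)) // (splitr e).
    by rewrite ltrD // (lt_trans yd).
  near (0 : R)^'+ => d; exists d => //.
  by near: d; exact: h.
have [C C0 hC] := seq_bound (expos D') (@l1 R n).
(* If [dotv w b] is at least N - n - 2C, the squared distance from [w] to b / N is at most 2(n + 2C)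
   / N; this choice makes it smaller than the square of [d / 2]. *)
pose N := Num.bound (8 * (n%:R + 2 * C) / d ^+ 2).
have d20 : 0 < d ^+ 2 by rewrite exprn_gt0.
have nC0 : 0 <= n%:R + 2 * C by rewrite addr_ge0 // mulr_ge0.
have hN : 8 * (n%:R + 2 * C) < d ^+ 2 * N%:R.
  rewrite [ltRHS]mulrC -ltr_pdivrMr //; apply: archi_boundP.
  by rewrite divr_ge0 ?mulr_ge0 // ltW.
have N0 : 0 < N%:R :> R.
  by rewrite -(pmulr_rgt0 _ d20); apply: le_lt_trans hN; rewrite mulr_ge0.
have [B [_ hB]] := lattice_ball R n N.
(* The radius is halved because b / N is itself only known to be within [d / 2] of [w]. *)
pose cond b f := f \in D' /\
  forall y, `|N%:R^-1 *: emb R b - y| < d / 2 -> good a I J f y.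
have [k hk] : exists k, forall b, (exists f, cond b f) -> cond b (k b).
  suff /choice[k hk] : forall b, exists f, (exists f', cond b f') -> cond b f.
    by exists k.
  move=> b; have [[f hf]|h] := pselect (exists f, cond b f); first by exists f.
  (* A default value that never enters [L], which keeps only points with a valid choice. *)
  by exists [ffun => 0].
pose L := [seq (1 : R, b, k b) | b <- B & `[<exists f, cond b f>]].
have LP p : p \in L -> exists b, [/\ b \in B, cond b (k b) & p = (1, b, k b)].
  case/mapP => b; rewrite mem_filter => /andP[/asboolP/hk hb bB] ->.
  by exists b.
exists (comb L); split.
  by apply: comb_submodule => // p /LP[b [_ [/MD Mk _] ->]].
move=> w0 /unit_scaling[c c0 [w w1 ->]]; apply: good_scale => //.
have close b : b \in B -> N%:R - n%:R - 2 * C <= dotv w b ->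
    `|N%:R^-1 *: emb R b - w| < d / 2.
  rewrite hB => bB wb; rewrite distrC; apply: sqn_normr_lt; first by rewrite divr_gt0.
  rewrite sqn_subZ w1.
  have -> : (d / 2) ^+ 2 = d ^+ 2 / 4 by field.
  rewrite -(ltr_pM2r (exprn_gt0 2 N0)).
  have -> : (1 - 2 * N%:R^-1 * dotv w b + N%:R^-1 ^+ 2 * sqn (emb R b)) * N%:R ^+ 2
     = N%:R ^+ 2 - 2 * N%:R * dotv w b + sqn (emb R b).
    by field; rewrite gt_eqF.
  nra.
have [b0 [b0B wb0]] := lattice_approx N w1; rewrite -hB in b0B.
have b0close := close b0 b0B.
have b0k : cond b0 (k b0).
  apply: hk; have [f fD hf] := hd w w1; exists f; split=> // y hy; apply: hf.
  rewrite -(subrK (N%:R^-1 *: emb R b0) w) -addrA (le_lt_trans (ler_normD _ _)) //.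
  rewrite (splitr d) ltrD // distrC b0close //.
  by rewrite (le_trans _ wb0) // gerBl mulr_ge0.
have b0L : (1, b0, k b0) \in L.
  by apply: map_f; rewrite mem_filter b0B andbT; apply/asboolP; exists (k b0).
have b0good : good a I J (k b0) w.
  by apply: b0k.2; apply: b0close; rewrite (le_trans _ wb0) // gerBl mulr_ge0.
apply: good_comb; first by move=> p /LP[b [_ _ ->]].
  by exists (1, b0, k b0).
move=> i p s /LP[b [bB hb ->]] /= sf sdom.
apply: hb.2; apply: close => //.
have [s0 s0f] : exists s0, s0 \in msupp (k b0 i) by case: b0good => /(_ i)/msupp_ex.
(* Comparison with the term at [b0]: the exponents [s] and [s0] cost at most [C] each, whence the
   [2 * C] in [close]. *)
have := sdom _ s0 b0L s0f; rewrite /= !dotvDr => h.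
have := le_trans (dotv_sphere_le s w1) (hC _ (mem_expos hb.1 sf)).
have := le_trans (dotv_sphere_le s0 w1) (hC _ (mem_expos b0k.1 s0f)).
rewrite !ler_norml => /andP[? ?] /andP[? ?]; lra.
Unshelve. all: by end_near. Qed.

End Infinity.

(** * Evaluation at positive points in exponential coordinates *)

Section Evaluation.
Variables (R : realType) (n : nat).
Implicit Types (f : laurent R n) (b s : expo n) (x y v w : 'rV[R]_n).

(** The value of [f] at the positive point exp(x), taken coordinatewise; see [leval_expR]. *)
Definition expeval x f : R := \sum_(s <- msupp f) f@_s * expR (dotv x s).

Lemma expR_intmul (y : R) (m : int) : expR y ^ m = expR (y * m%:~R).
Proof.
case: m => k; first by rewrite -exprnP expRM_natr.
by rewrite NegzE -exprnN mulrNz mulrN expRN expRM_natr.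
Qed.

Lemma leval_expR x f : leval (\row_j expR (x 0 j)) f = expeval x f.
Proof.
apply: eq_bigr => s _; congr (_ * _); rewrite /dotv expR_sum.
by apply: eq_bigr => j _; rewrite mxE expR_intmul.
Qed.

Lemma cvg_expeval (T : Type) (F : set_system T) (g : T -> 'rV[R]_n) x f :
  Filter F -> g @ F --> x -> expeval (g z) f @[z --> F] --> expeval x f.
Proof.
move=> FF gx; apply: cvg_sum_seq => s; apply: cvgM; first exact: cvg_cst.
apply: (cvg_comp (fun z => dotv (g z) s) (@expR R)).
  exact: (@cvg_dotv R n T F g x s FF gx).
exact: continuous_expR.
Qed.

Lemma expeval_continuous f : continuous (fun x => expeval x f : R^o).
Proof. by move=> x; exact: (@cvg_expeval _ (nbhs x) id x f _ cvg_id). Qed.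

Lemma closed_ball_compact (r : R) : compact [set x : 'rV[R]_n | `|x| <= r].
Proof.
apply: bounded_closed_compact.
  by exists r; split; [exact: num_real | move=> r' rr' x /= xr; exact: le_trans (ltW rr')].
have /continuous_closedP : continuous (fun x : 'rV[R]_n => `|x| : R^o).
  exact: norm_continuous.
by move=> /(_ _ (@closed_le _ r)).
Qed.

Lemma sqn_le_norm x : sqn x <= n%:R * `|x| ^+ 2.
Proof.
have -> : n%:R * `|x| ^+ 2 = \sum_(j < n) `|x| ^+ 2.
  by rewrite sumr_const card_ord mulr_natl.
apply: ler_sum => j _; rewrite -real_normK ?num_real //.
by rewrite ler_pXn2r ?nnegrE // normr_coord.
Qed.

Lemma l1_le_norm b : l1 R b <= n%:R * `|emb R b|.
Proof.
have -> : n%:R * `|emb R b| = \sum_(j < n) `|emb R b|.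
  by rewrite sumr_const card_ord mulr_natl.
by apply: ler_sum => j _; have := normr_coord (emb R b) j; rewrite mxE.
Qed.

End Evaluation.

(* The single largest negative weight is beaten, by a factor [Q], by the weight
   of a positive coefficient, which therefore absorbs all negative terms. *)
Lemma dominated_sum_gt0 (R : realType) (X : eqType) (S : seq X) (c g : X -> R)
    (Q : R) :
  (forall s, s \in S -> 0 < g s) ->
  (forall s, s \in S -> c s < 0 ->
     exists s', [/\ s' \in S, 0 < c s' & Q * g s <= g s']) ->
  (forall s', s' \in S -> 0 < c s' -> \sum_(s <- S) `|c s| < Q * c s') ->
  (exists2 s, s \in S & 0 < c s) ->
  0 < \sum_(s <- S) c s * g s.
Proof.
move=> g0 neg hQ [sp spS sp0].
have [/hasP[s0 s0S s0n]|/hasPn nneg] := boolP (has (fun s => c s < 0) S); last first.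
  apply: psum_seq_gt0; last by exists sp; rewrite ?mulr_gt0 ?g0.
  by move=> s sS; rewrite mulr_ge0 ?(ltW (g0 _ sS)) // leNgt nneg.
have s0f : s0 \in [seq s <- S | c s < 0] by rewrite mem_filter s0n.
have [sm] := seq_argmax g s0f; rewrite mem_filter => /andP[smn smS] smax.
have [s' [s'S s'0 Qs']] := neg _ smS smn.
rewrite (perm_big _ (perm_to_rem s'S)) /= big_cons.
have := hQ _ s'S s'0; rewrite (perm_big _ (perm_to_rem s'S)) /= big_cons => hs'.
have gm := g0 _ smS.
have rest : - (g sm * \sum_(s <- rem s' S) `|c s|) <= \sum_(s <- rem s' S) c s * g s.
  rewrite mulr_sumr -sumrN big_seq [leRHS]big_seq; apply: ler_sum => s /mem_rem sS.
  case: (ltP (c s) 0) => cs.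
    rewrite ltr0_norm //.
    have : g s <= g sm by apply: smax; rewrite mem_filter cs.
    nra.
  rewrite ger0_norm //; have := g0 _ sS; nra.
apply: lt_le_trans (lerD (lexx _) rest).
rewrite subr_gt0.
apply: (@lt_le_trans _ _ (g sm * (Q * c s'))).
  rewrite ltr_pM2l //; apply: le_lt_trans hs'; by rewrite lerDr.
by rewrite mulrA [g sm * Q]mulrC [leLHS]mulrC ler_pM2l.
Qed.

(** This form suits truncated sums, which may have lost every positive coefficient: [neg] then rules
    out negative ones too. *)
Lemma dominated_sum_ge0 (R : realType) (X : eqType) (S : seq X) (c g : X -> R)
    (Q : R) :
  (forall s, s \in S -> 0 < g s) ->
  (forall s, s \in S -> c s < 0 ->
     exists s', [/\ s' \in S, 0 < c s' & Q * g s <= g s']) ->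
  (forall s', s' \in S -> 0 < c s' -> \sum_(s <- S) `|c s| < Q * c s') ->
  0 <= \sum_(s <- S) c s * g s.
Proof.
move=> g0 neg hQ.
have [sp|npos] := pselect (exists2 s, s \in S & 0 < c s).
  by apply: ltW; exact: dominated_sum_gt0 hQ sp.
rewrite big_seq sumr_ge0 // => s sS; rewrite mulr_ge0 ?(ltW (g0 _ sS)) //.
rewrite leNgt; apply/negP => /(neg _ sS)[s' [s'S s'0 _]].
by apply: npos; exists s'.
Qed.

(** * Uniform domination of negative coefficients *)

Section Margin.
Variables (R : realType) (n K : nat) (a : 'I_K -> expo n) (I J : {set 'I_K}).
Implicit Types (v w x : 'rV[R]_n) (f : lvec R n K) (b s t : expo n).

(** A negative coefficient never sits at a top exponent, so a top exponent beats it strictly.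
    Compactness makes the gap uniform on the sphere, and homogeneity scales it; the sup norm of a
    unit vector is at most 1. *)
Lemma good_margin f : (forall w, w != 0 -> good a I J f w) ->
  exists2 d : R, 0 < d & forall x i s, x != 0 -> s \in msupp (f i) ->
    (f i)@_s < 0 -> exists s', [/\ s' \in msupp (f i), 0 < (f i)@_s' &
       dotv x s + d * `|x| <= dotv x s'].
Proof.
move=> gf.
pose Q (d : R) w := forall i s, s \in msupp (f i) -> (f i)@_s < 0 ->
  exists s', [/\ s' \in msupp (f i), 0 < (f i)@_s' & dotv w s + d <= dotv w s'].
have h : \forall d \near 0^'+, @sphere R n `<=` Q d.
  have /compact_near_coveringP := @sphere_compact R n; apply => w w1.
  have [f0 fp _] := gf w (sphere_neq0 w1).
  apply: (@filter_forall _ _ _ (filter_prod (nbhs w) (nbhs 0^'+))) => i.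
  apply: (@filter_seq _ (filter_prod (nbhs w) (nbhs 0^'+)) _ (msupp (f i))) => s sf.
  have [sneg|] := boolP ((f i)@_s < 0); last by move=> _; apply: filterS filterT.
  have [s' ts'] := vtop_ex w (f0 i).
  have ss' : 0 < dotv w (s' - s).
    rewrite dotvDr dotvNr subr_gt0 lt_neqAle; case/vtopP: (ts') => s'f ->//.
    rewrite andbT; apply/eqP => e; have /fp : vtop w (f i) s.
      by apply/vtopP; split=> // c cf; rewrite e; case/vtopP: ts' => _; exact.
    by rewrite ltNge ltW.
  (* Half the gap at [w] lies above [d] and below the gap at every nearby [x]. *)
  have e20 : 0 < dotv w (s' - s) / 2 by rewrite divr_gt0.
  have e2 : dotv w (s' - s) / 2 < dotv w (s' - s) by lra.
  near=> x d => _ /=; exists s'; split; [by case/vtopP: ts' | exact: fp ts' |].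
  have dl : d < dotv w (s' - s) / 2 by near: d; exact: nbhs_right_lt.
  have xl : dotv w (s' - s) / 2 < dotv x (s' - s).
    by near: x; exact: (cvgr_gt _ (@dotv_continuous R n (s' - s) w) _ e2).
  by move: xl dl; rewrite !dotvDr !dotvNr; lra.
near (0 : R)^'+ => d.
have hd : @sphere R n `<=` Q d by near: d; exact: h.
exists d => // x i s /unit_scaling[c c0 [u u1 ->]] sf sneg.
have [s' [s'f s'p us']] := hd u u1 i s sf sneg; exists s'; split=> //.
rewrite !dotvZl; apply: le_trans (_ : c * (dotv u s + d) <= _); last first.
  by rewrite ler_pM2l.
rewrite mulrDr lerD2l mulrC ler_pM2r // normrZ gtr0_norm // ger_pMr //.
by apply: normr_le => // j; exact: sphere_coord.
Unshelve. all: by end_near. Qed.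

Lemma coef_ratio f : exists2 Q : R, 1 <= Q & forall i s', s' \in msupp (f i) ->
  0 < (f i)@_s' -> \sum_(s <- msupp (f i)) `|(f i)@_s| < Q * (f i)@_s'.
Proof.
pose l := [seq (i, s) | i <- enum 'I_K, s <- (msupp (f i) : seq (expo n))].
pose g (p : 'I_K * expo n) :=
  (\sum_(s <- msupp (f p.1)) `|(f p.1)@_s|) / (f p.1)@_p.2.
have [C C0 hC] := seq_bound l g.
(* The added 1 gives both [1 <= Q] and the strict inequality. *)
exists (C + 1); first by rewrite lerDr.
move=> i s' s'f s'0; rewrite -ltr_pdivrMr //.
have : g (i, s') <= C by apply: hC; apply/allpairsPdep; exists i, s'; rewrite mem_enum.
by move/le_lt_trans; apply; rewrite ltrDl.
Qed.

End Margin.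

(** * Continuous cutoffs and the small-scale limit of coefficients *)

Section Cutoffs.
Variables (R : realType) (n K : nat) (A : R).
Implicit Types (x y : 'rV[R]_n) (f : lvec R n K) (s b : expo n).

Definition outer x : R := Num.min 1 (Num.max 0 (`|x| - A)).

(** The product of positive parts switches [f] off, continuously, wherever some entry fails to be
    positive at exp(x). Weighted values are therefore never negative. *)
Definition inner f x : R :=
  Num.max 0 (A + 1 - `|x|) * \prod_i Num.max 0 (expeval x (f i)).

(* A flag and a vector: [(true, f)] carries the outer cutoff, [(false, f)]
   the inner one. *)
Definition weight (g : bool * lvec R n K) x : R :=
  if g.1 then outer x else inner g.2 x.

Lemma weight_ge0 g x : 0 <= weight g x.
Proof.
rewrite /weight; case: ifP => _.
  by rewrite /outer le_min ler01 le_max lexx.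
rewrite /inner mulr_ge0 ?le_max ?lexx //.
by apply: prodr_ge0 => i _; rewrite le_max lexx.
Qed.

Lemma outer_eq1 x : A + 1 <= `|x| -> outer x = 1.
Proof.
by move=> h; rewrite /outer min_l // le_max; apply/orP; right; lra.
Qed.

Lemma outer_gt0 x : 0 < outer x -> A < `|x|.
Proof. by rewrite /outer lt_min lt_max ltxx /= subr_gt0 => /andP[]. Qed.

Lemma inner_eq0 f x : A + 1 <= `|x| -> inner f x = 0.
Proof. by move=> h; rewrite /inner max_l ?mul0r //; lra. Qed.

Lemma inner_gt0 f x i : 0 < inner f x -> 0 < expeval x (f i).
Proof.
move=> h; rewrite ltNge; apply/negP => fi; move: h.
by rewrite /inner (bigD1 i) //= (max_l fi) mul0r mulr0 ltxx.
Qed.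

Lemma inner_pos f x : `|x| <= A -> (forall i, 0 < expeval x (f i)) -> 0 < inner f x.
Proof.
move=> xA fx; rewrite /inner mulr_gt0 //; first by rewrite lt_max; apply/orP; right; lra.
by apply: prodr_gt0 => i _; rewrite lt_max fx orbT.
Qed.

Lemma cvg_max (T : Type) (F : set_system T) (u v : T -> R) (p q : R) :
  Filter F -> u @ F --> p -> v @ F --> q ->
  Num.max (u x) (v x) @[x --> F] --> Num.max p q.
Proof.
move=> FF up vq; rewrite maxr_absE.
under eq_cvg do rewrite maxr_absE.
apply: cvgM; last exact: cvg_cst; apply: cvgD; first exact: cvgD.
by apply: cvg_norm; exact: cvgB.
Qed.

Lemma cvg_weight g (T : Type) (F : set_system T) (u : T -> 'rV[R]_n) x :
  Filter F -> u @ F --> x -> weight g (u z) @[z --> F] --> weight g x.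
Proof.
move=> FF ux; have nx : `|u z| @[z --> F] --> `|x| by exact: cvg_norm.
rewrite /weight; case: ifP => _; rewrite /outer /inner.
  rewrite minr_absE; under eq_cvg do rewrite minr_absE.
  have mx : Num.max 0 (`|u z| - A) @[z --> F] --> Num.max 0 (`|x| - A).
    by apply: cvg_max; [exact: cvg_cst | apply: cvgB => //; exact: cvg_cst].
  apply: cvgM; last exact: cvg_cst; apply: cvgB; last first.
    by apply: cvg_norm; apply: cvgB => //; exact: cvg_cst.
  by apply: cvgD => //; exact: cvg_cst.
apply: cvgM.
  by apply: cvg_max; [exact: cvg_cst | apply: cvgB => //; exact: cvg_cst].
apply: (cvg_big (U := R) (op := *%R) (x0 := 1)); first exact: mul_continuous.
by move=> i _; apply: cvg_max; [exact: cvg_cst | exact: cvg_expeval].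
Qed.

(* Up to the factor [expR (- t * sqn b)], the coefficient at [b] of the weighted
   sum of monomials, evaluated at the rescaled exponent [x = 2 t b]. *)
Definition profile (G : seq (bool * lvec R n K)) i (t : R) x : R :=
  \sum_(g <- G) \sum_(s <- msupp (g.2 i))
     (g.2 i)@_s * weight g (x - (2 * t) *: emb R s) *
     expR (dotv x s - t * sqn (emb R s)).

Lemma profile0 G i x :
  profile G i 0 x = \sum_(g <- G) weight g x * expeval x (g.2 i).
Proof.
apply: eq_bigr => g _; rewrite /expeval mulr_sumr; apply: eq_bigr => s _.
by rewrite mulr0 scale0r subr0 mul0r subr0; ring.
Qed.

Lemma cvg_profile G i (T : Type) (F : set_system T) (u : T -> 'rV[R]_n)
    (t : T -> R) x :
  Filter F -> u @ F --> x -> t @ F --> (0 : R) ->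
  profile G i (t z) (u z) @[z --> F] --> profile G i 0 x.
Proof.
move=> FF ux t0; apply: cvg_sum_seq => g; apply: cvg_sum_seq => s.
apply: cvgM.
  apply: cvgM; first exact: cvg_cst.
  apply: cvg_weight; apply: cvgB => //; apply: cvgZr_tmp.
  by apply: cvgM => //; exact: cvg_cst.
have h : dotv (u z) s - t z * sqn (emb R s) @[z --> F] -->
    dotv x s - 0 * sqn (emb R s).
  apply: cvgB; first exact: (@cvg_dotv R n T F u x s FF ux).
  by apply: cvgM => //; exact: cvg_cst.
by apply: (cvg_comp _ (@expR R) h); exact: continuous_expR.
Qed.

(** The profile is jointly continuous at [t = 0], where it is the positive sum of the hypothesis;
    compactness of the ball gives one range of [t] for all [x]. *)
Lemma near_profile_gt0 G (r : R) :
  (forall x i, `|x| <= r -> 0 < \sum_(g <- G) weight g x * expeval x (g.2 i)) ->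
  \forall t \near 0^'+, forall x, `|x| <= r -> forall i, 0 < profile G i t x.
Proof.
move=> h.
have /compact_near_coveringP := @closed_ball_compact R n r; apply => x xr.
apply: (@filter_forall _ _ _ (filter_prod (nbhs x) (nbhs 0^'+))) => i.
have c2 : z.2 @[z --> filter_prod (nbhs x) (nbhs (0 : R)^'+)] --> (0 : R).
  apply: cvg_trans cvg_snd _; exact: cvg_within.
have c1 : z.1 @[z --> filter_prod (nbhs x) (nbhs (0 : R)^'+)] --> x.
  exact: cvg_fst.
have h0 := h x i xr; rewrite -profile0 in h0.
have hc := cvg_profile (G := G) (i := i) _ c1 c2.
by apply: filterS (cvgr_gt _ (hc _) _ h0).
Qed.

End Cutoffs.

(** * Coefficients of the Gaussian sum *)

Section Coefficients.
Variables (R : realType) (n K : nat) (A t : R) (B : seq (expo n)).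
Variable G : seq (bool * lvec R n K).
Hypothesis uniqB : uniq B.

(** Terms of weight zero are removed: [good_comb] asks for positive coefficients, and a vector that
    is switched off must not count as dominant. *)
Definition gauss_terms : seq (R * expo n * lvec R n K) :=
  [seq p <- [seq (expR (- (t * sqn (emb R b))) *
                  weight A g ((2 * t) *: emb R b), b, g.2) | b <- B, g <- G]
  | 0 < p.1.1].

Lemma gauss_termsP p : p \in gauss_terms ->
  exists b g, [/\ b \in B, g \in G, 0 < weight A g ((2 * t) *: emb R b),
     p.1.2 = b & p.2 = g.2].
Proof.
rewrite mem_filter => /andP[+ /allpairsP[[b g] /= [bB gG pE]]].
by rewrite pE /= pmulr_rgt0 ?expR_gt0 // => wg; exists b, g.
Qed.

Lemma mem_gauss_terms b g : b \in B -> g \in G ->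
  0 < weight A g ((2 * t) *: emb R b) ->
  exists2 p, p \in gauss_terms & p.1.2 = b /\ p.2 = g.2.
Proof.
move=> bB gG wg.
exists (expR (- (t * sqn (emb R b))) * weight A g ((2 * t) *: emb R b), b, g.2) => //.
rewrite mem_filter /= mulr_gt0 ?expR_gt0 //=.
by apply/allpairsP; exists (b, g).
Qed.

(** Substitution [s = b - b']; since [B] has no repetitions, each exponent is counted once. *)
Lemma sum_shift (W : expo n -> R) (f : laurent R n) (b : expo n) :
  \sum_(b' <- B) W b' * f@_(b - b') =
  \sum_(s <- msupp f | b - s \in B) W (b - s) * f@_s.
Proof.
transitivity (\sum_(b' <- B) \sum_(s <- msupp f | s == b - b') W b' * f@_s).
  apply: eq_bigr => b' _.
  have [bf|bf] := boolP (b - b' \in msupp f).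
    by rewrite -big_filter (filter_pred1_uniq (fset_uniq _) bf) big_seq1.
  rewrite (mcoeff_outdom bf) mulr0 big_seq_cond big1 // => s /andP[sf /eqP e].
  by rewrite -e sf in bf.
rewrite (exchange_big_dep predT) //= [RHS]big_mkcond /=; apply: eq_bigr => s _.
rewrite (eq_bigl (fun b' => b' == b - s)); last first.
  by move=> b'; apply/eqP/eqP => ->; rewrite subKr.
case: ifP => bs.
  by rewrite -big_filter (filter_pred1_uniq uniqB bs) big_seq1.
rewrite big_seq_cond big1 // => b' /andP[b'B /eqP e].
by rewrite -e b'B in bs.
Qed.

Lemma gauss_coef i b :
  (comb gauss_terms i)@_b = expR (- (t * sqn (emb R b))) *
   \sum_(g <- G) \sum_(s <- msupp (g.2 i) | b - s \in B)
     (g.2 i)@_s * weight A g ((2 * t) *: emb R b - (2 * t) *: emb R s) *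
     expR (dotv ((2 * t) *: emb R b) s - t * sqn (emb R s)).
Proof.
rewrite comb_coef big_filter big_mkcond /=.
(* The filtered terms had coefficient zero, so the sum may run over all pairs. *)
rewrite (eq_big_seq (fun p : R * expo n * lvec R n K => p.1.1 * (p.2 i)@_(b - p.1.2))); last first.
  move=> p /allpairsP[[b' g] /= [_ _ ->]] /=; case: ifPn => //.
  rewrite pmulr_rgt0 ?expR_gt0 // lt_neqAle weight_ge0 andbT negbK => /eqP <-.
  by rewrite mulr0 mul0r.
rewrite big_allpairs_dep /= exchange_big /= mulr_sumr; apply: eq_bigr => g _.
rewrite (sum_shift (fun b' => expR (- (t * sqn (emb R b'))) *
  weight A g ((2 * t) *: emb R b'))) mulr_sumr; apply: eq_bigr => s _.
have -> : expR (- (t * sqn (emb R (b - s)))) = expR (- (t * sqn (emb R b))) *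
    expR (dotv ((2 * t) *: emb R b) s - t * sqn (emb R s)).
  rewrite -expRD embB -[emb R s]scale1r sqn_subZ scale1r dotvZl; congr expR.
  by ring.
by rewrite embB scalerBr; ring.
Qed.

End Coefficients.

(** * Nonnegativity of all coefficients *)

Section Lift.
Variables (R : realType) (n K : nat) (a : 'I_K -> expo n) (I J : {set 'I_K}).
Implicit Types (v w x : 'rV[R]_n) (f : lvec R n K) (b s : expo n).

(** The first bound keeps the shifted arguments of the cutoffs within distance 1 of [x]; the second
    keeps the Gaussian correction in the exponent at most [1 / 2]. *)
Lemma near_small_scale (E : seq (expo n)) : \forall t \near (0 : R)^'+,
  forall s, s \in E -> 2 * t * `|emb R s| <= 1 /\ t * sqn (emb R s) <= 1 / 2.
Proof.
apply: (@filter_seq _ ((0 : R)^'+)) => s _.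
have c1 : 0 < 2 * (`|emb R s| + 1) by rewrite mulr_gt0 // ltr_wpDl.
have c2 : 0 < 2 * (sqn (emb R s) + 1) by rewrite mulr_gt0 // ltr_wpDl // sqn_ge0.
near=> t.
have t0 : 0 < t by [].
have t1 : t * (2 * (`|emb R s| + 1)) < 1.
  rewrite -ltr_pdivlMr // div1r.
  by near: t; apply: nbhs_right_lt; rewrite invr_gt0.
have t2 : t * (2 * (sqn (emb R s) + 1)) < 1.
  rewrite -ltr_pdivlMr // div1r.
  by near: t; apply: nbhs_right_lt; rewrite invr_gt0.
by split; nra.
Unshelve. all: by end_near. Qed.

Lemma truncated_sum_ge0 (f : laurent R n) (B : seq (expo n)) b (rho d Q t : R) :
  let x := (2 * t) *: emb R b in
  0 < t -> 1 <= Q -> 2 * Q <= d * `|x| ->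
  (forall b, (b \in B) = (sqn (emb R b) <= rho)) ->
  (forall s, s \in msupp f -> t * sqn (emb R s) <= 1 / 2) ->
  (forall s', s' \in msupp f -> 0 < f@_s' ->
     \sum_(s <- msupp f) `|f@_s| < Q * f@_s') ->
  (forall s, s \in msupp f -> f@_s < 0 -> exists s',
     [/\ s' \in msupp f, 0 < f@_s' & dotv x s + d * `|x| <= dotv x s']) ->
  0 <= \sum_(s <- msupp f | b - s \in B)
          f@_s * expR (dotv x s - t * sqn (emb R s)).
Proof.
move=> x t0 Q1 dx hB ts hQ hd; rewrite -big_filter.
have Q0 : 0 < Q by exact: lt_le_trans Q1.
apply: (@dominated_sum_ge0 _ _ _ _ _ Q).
- by move=> s _; exact: expR_gt0.
- move=> s; rewrite mem_filter => /andP[bsB sf] sneg.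
  have [s' [s'f s'p xs']] := hd s sf sneg.
  have q' := ts _ s'f; have q0 := sqn_ge0 (emb R s).
  exists s'; split=> //.
    rewrite mem_filter s'f andbT hB; rewrite hB in bsB; apply: le_trans bsB.
    rewrite !embB -[emb R s]scale1r -[emb R s']scale1r !sqn_subZ ?scale1r.
    (* After scaling by [t], the gain of at least d|x| >= 2 in the pairing outweighs t|s'|^2 <= 1/2,
       so b - s' is no longer than b - s. *)
    rewrite !mulr1 expr1n !mul1r -(ler_pM2l t0).
    move: xs'; rewrite /x !dotvZl -/x; move: (mulr_ge0 (ltW t0) q0); lra.
  have e1 : Q <= expR (d * `|x| - 1 / 2).
    by apply: le_trans (expR_ge1Dx _); lra.
  apply: (@le_trans _ _ (expR (dotv x s) * expR (d * `|x| - 1 / 2))).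
    rewrite mulrC; apply: ler_pM => //; rewrite ?expR_ge0 ?(ltW Q0) //.
    by rewrite ler_expR gerBl mulr_ge0 // ltW.
  by rewrite -expRD ler_expR; lra.
- move=> s'; rewrite mem_filter => /andP[_ s'f] s'p.
  (* Truncation only shrinks the sum of absolute values. *)
  apply: le_lt_trans (hQ s' s'f s'p); rewrite big_filter big_mkcond /=.
  by apply: ler_sum => s _; case: ifP.
Qed.

(** With x = 2tb, coefficients for |x| <= A + 2 are untruncated and positive by [near_profile_gt0];
    beyond, only [f1] remains, with weight 1, and [truncated_sum_ge0] applies. Dominant exponents
    arise far out, where only [f1] is present, so goodness is inherited from it. *)
Lemma positive_lift (M : lvec R n K -> Prop) f1 : is_submodule M ->
  (forall x, exists f, M f /\ forall i, 0 < expeval x (f i)) ->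
  M f1 -> (forall w, w != 0 -> good a I J f1 w) ->
  exists h, [/\ M h, forall i, Apos (h i) & forall w, w != 0 -> good a I J h w].
Proof.
move=> HM locr Mf1 gf1.
have [d d0 hd] := good_margin gf1.
have [Q Q1 hQ] := coef_ratio f1.
(* From norm [A] on, the margin d|x| reaches [2 * Q], as [truncated_sum_ge0] requires. *)
pose A := 2 * Q / d.
have dA : d * A = 2 * Q by rewrite /A mulrC divfK // gt_eqF.
have A0 : 0 < A by rewrite divr_gt0 // mulr_gt0 // (lt_le_trans ltr01).
have xN0 x : A <= `|x| -> x != 0.
  by move=> xA; rewrite -normr_gt0; exact: lt_le_trans xA.
have big_exp x : A <= `|x| -> 2 * Q <= expR (d * `|x|).
  move=> xA; apply: le_trans (expR_ge1Dx _); rewrite -dA.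
  have : d * A <= d * `|x| by rewrite ler_pM2l.
  lra.
have outer_pos x i : A <= `|x| -> 0 < expeval x (f1 i).
  move=> xA; have x0 := xN0 _ xA; apply: (@dominated_sum_gt0 _ _ _ _ _ Q).
  - by move=> s _; exact: expR_gt0.
  - move=> s sf sneg; have [s' [s'f s'p xs']] := hd x i s x0 sf sneg.
    exists s'; split=> //.
    apply: le_trans (_ : expR (dotv x s + d * `|x|) <= _); last by rewrite ler_expR.
    rewrite expRD mulrC ler_pM2l ?expR_gt0 //.
    by apply: le_trans (big_exp _ xA); lra.
  - by move=> s' s'f s'p; exact: hQ.
  - have [f0 fp _] := gf1 x x0; have [s ts] := vtop_ex x (f0 i).
    by exists s; [case/vtopP: ts | exact: fp ts].
pose U f : set 'rV[R]_n := [set x | forall i, 0 < expeval x (f i)].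
have := @closed_ball_compact R n A; rewrite compact_cover => /(_ _ [set f | M f] U).
case=> [f _|x _|D' D'M cov].
- rewrite openE => x /= Ux; apply: (@filter_forall _ _ _ (nbhs x)) => i.
  exact: (cvgr_gt _ (@expeval_continuous R n (f i) x) _ (Ux i)).
- by have [f [Mf fx]] := locr x; exists f.
have MD f : f \in D' -> M f by move=> /D'M/set_mem.
pose G := (true, f1) :: [seq (false, f) | f : lvec R n K <- D'].
have GP g : g \in G -> g = (true, f1) \/ exists2 f, f \in D' & g = (false, f).
  by rewrite inE => /predU1P[|/mapP[f]]; [left | right; exists f].
have GM g : g \in G -> M g.2 /\ g.2 \in f1 :: (D' : seq _).
  move=> /GP[->|[f fD ->]] /=; rewrite inE ?eqxx //.
  by rewrite fD orbT; split=> //; exact: MD.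
have total_pos x i : 0 < \sum_(g <- G) weight A g x * expeval x (g.2 i).
  apply: psum_seq_gt0.
    move=> g gG; have := weight_ge0 A g x; rewrite le_eqVlt => /predU1P[<-|wg].
      by rewrite mul0r.
    rewrite mulr_ge0 ?weight_ge0 // ltW //.
    case/GP: gG wg => [->|[f fD ->]]; rewrite /weight /=; last exact: inner_gt0.
    by move=> /outer_gt0/ltW; exact: outer_pos.
  have [xA|xA] := leP `|x| A.
    have [f /= fD Ufx] := cov _ xA; exists (false, f).
      by rewrite inE /= map_f.
    by rewrite mulr_gt0 //= /weight /= inner_pos.
  exists (true, f1); first by rewrite mem_head.
  rewrite mulr_gt0 ?outer_pos ?(ltW xA) //= /weight /= /outer.
  by rewrite lt_min ltr01 lt_max subr_gt0 xA orbT.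
pose E := expos (f1 :: (D' : seq _)).
have [C C0 hC] := seq_bound E (@l1 R n).
(* Beyond [A + 2], a shift of length at most 1 stays beyond [A + 1], where both cutoffs are
   constant. *)
have hprof := near_profile_gt0 (fun x i (_ : `|x| <= A + 2) => total_pos x i).
near (0 : R)^'+ => t.
have t0 : 0 < t by [].
have ts s : s \in E -> 2 * t * `|emb R s| <= 1 /\ t * sqn (emb R s) <= 1 / 2.
  by move: s; near: t; exact: near_small_scale.
have tp : forall x, `|x| <= A + 2 -> forall i, 0 < profile A G i t x.
  by near: t; exact: hprof.
have t20 : 0 < 2 * t by rewrite mulr_gt0.
(* [X1] makes the ball contain every [b - s] with |2tb| <= A + 2; the factor [n.+1] passes from the
   sup norm to the Euclidean one. [X2] bounds [dotv w b] for points still carrying an inner term. *)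
pose X1 := n.+1%:R * (A + 3) / (2 * t); pose X2 := n%:R * (A + 1) / (2 * t).
have X10 : 0 <= X1 by rewrite divr_ge0 ?mulr_ge0 //; lra.
have X20 : 0 <= X2 by rewrite divr_ge0 ?mulr_ge0 //; lra.
pose N := Num.bound (X1 + X2 + 2 * C + n%:R).
have hN : X1 + X2 + 2 * C + n%:R < N%:R.
  by apply: archi_boundP; rewrite !addr_ge0 // mulr_ge0.
have [B [uB hB]] := lattice_ball R n N.
have normx b : `|(2 * t) *: emb R b| = 2 * t * `|emb R b|.
  by rewrite normrZ gtr0_norm.
have memB b s : `|(2 * t) *: emb R b| <= A + 2 -> s \in E -> b - s \in B.
  rewrite normx => bA /ts[s1 _]; rewrite hB embB.
  apply: le_trans (sqn_le_norm _) _.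
  have y1 : 2 * t * `|emb R b - emb R s| <= A + 3.
    have : 2 * t * `|emb R b - emb R s| <= 2 * t * (`|emb R b| + `|emb R s|).
      by rewrite ler_pM2l // ler_normB.
    lra.
  have y2 : `|emb R b - emb R s| <= (A + 3) / (2 * t) by rewrite ler_pdivlMr // mulrC.
  have y3 : n.+1%:R * `|emb R b - emb R s| <= N%:R.
    apply: le_trans (_ : X1 <= _); last by move: X20 C0 hN (ler0n R n); lra.
    by rewrite /X1 -mulrA ler_pM2l.
  apply: le_trans (_ : (n.+1%:R * `|emb R b - emb R s|) ^+ 2 <= _); last first.
    by rewrite ler_pXn2r ?nnegrE ?mulr_ge0.
  rewrite exprMn ler_wpM2r ?sqr_ge0 // -natrX ler_nat (leq_trans (leqnSn n)) //.
  by rewrite -[X in leq X _]expn1 leq_pexp2l.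
have profE b i : `|(2 * t) *: emb R b| <= A + 2 ->
    0 < (comb (gauss_terms A t B G) i)@_b.
  move=> bA; rewrite gauss_coef // mulr_gt0 ?expR_gt0 //.
  have := tp _ bA i; congr (_ < _); apply: eq_big_seq => g /GM[_ gf].
  rewrite [RHS]big_mkcond /= !big_seq; apply: eq_bigr => s sf.
  by rewrite (memB b s bA) //; exact: mem_expos gf sf.
have coef_ge0 b i : 0 <= (comb (gauss_terms A t B G) i)@_b.
  have [bA|bA] := leP `|(2 * t) *: emb R b| (A + 2); first exact/ltW/profE.
  rewrite gauss_coef // mulr_ge0 ?expR_ge0 //.
  set x := (2 * t) *: emb R b in bA *.
  have far s : s \in E -> A + 1 <= `|x - (2 * t) *: emb R s|.
    move=> /ts[s1 _]; have := lerB_dist x ((2 * t) *: emb R s).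
    by rewrite normx; lra.
  rewrite big_cons [X in _ + X]big_seq [X in _ + X]big1 ?addr0 => [|g gG]; last first.
    case/mapP: gG => f fD -> /=; rewrite big_seq_cond big1 // => s /andP[sf _].
    rewrite /weight /= inner_eq0 ?mulr0 ?mul0r // far //.
    by apply: (mem_expos (f := f)) sf; rewrite inE fD orbT.
  have xA : A <= `|x| by lra.
  have f1E s : s \in msupp (f1 i) -> s \in E.
    by apply: mem_expos; rewrite mem_head.
  rewrite big_seq_cond (eq_bigr (fun s => (f1 i)@_s *
    expR (dotv x s - t * sqn (emb R s)))) -?big_seq_cond; last first.
    by move=> s /andP[/f1E/far sE _]; rewrite /weight /= outer_eq1 // mulr1.
  apply: (truncated_sum_ge0 (Q := Q) (d := d)) => //.
  - by rewrite -dA ler_pM2l.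
  - by move=> s /f1E/ts[].
  - by move=> s' s'f; exact: hQ.
  - by move=> s sf; apply: hd => //; exact: xN0.
exists (comb (gauss_terms A t B G)); split.
- by apply: comb_submodule => // p /gauss_termsP[b [g [_ /GM[Mg _] _ _ ->]]].
(* The exponent 0 corresponds to [x = 0], in the range of strictly positive coefficients. *)
- move=> i; split=> //; apply: (@msupp_neq0 _ _ _ 0); rewrite -mcoeff_neq0 gt_eqF //.
  apply: profE; rewrite /emb map_mx0 scaler0 normr0; lra.
move=> w0 /unit_scaling[c c0 [w w1 ->]]; apply: good_scale => //.
have gw := gf1 w (sphere_neq0 w1).
have [b0 [b0B wb0]] := lattice_approx N w1; rewrite -hB in b0B.
have dot_le b : dotv w b <= n%:R * `|emb R b|.
  apply: le_trans (ler_norm _) _; apply: le_trans (dotv_sphere_le _ w1) _.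
  exact: l1_le_norm.
(* Otherwise [dotv w b0] would be at most [X2], below N - n. Hence the term of [f1] at [b0] has full
   weight. *)
have b0far : A + 1 <= `|(2 * t) *: emb R b0|.
  rewrite normx leNgt; apply/negP => h.
  have h1 : `|emb R b0| <= (A + 1) / (2 * t) by rewrite ler_pdivlMr // mulrC ltW.
  have : n%:R * `|emb R b0| <= X2 by rewrite /X2 -mulrA ler_wpM2l.
  by have := dot_le b0; move: X10 C0 hN wb0; lra.
have [|p0 p0L [p0b p0f]] := @mem_gauss_terms R n K A t B G b0 (true, f1) b0B (mem_head _ _).
  by rewrite /weight /= outer_eq1.
apply: good_comb.
- by move=> p; rewrite mem_filter => /andP[].
- by exists p0 => //; rewrite p0f.
move=> i p s /gauss_termsP[b [g [bB gG wg pb pf]]] sf sdom.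
rewrite pf; case/GP: (gG) => [->//|[f fD gE]].
(* An inner term sits at a point with [dotv w b] at most [X2], too small to dominate the term at
   [b0]. *)
have bnear : `|(2 * t) *: emb R b| < A + 1.
  rewrite ltNge; apply/negP => h; move: wg.
  by rewrite gE /weight /= inner_eq0 // ltxx.
have [s0 s0f] : exists s0, s0 \in msupp (f1 i) by case: gw => /(_ i)/msupp_ex.
have := sdom p0 s0 p0L; rewrite p0f => /(_ s0f); rewrite pb p0b !dotvDr.
have h1 : `|emb R b| <= (A + 1) / (2 * t).
  by rewrite ler_pdivlMr // mulrC -normx ltW.
have : n%:R * `|emb R b| <= X2 by rewrite /X2 -mulrA ler_wpM2l.
have sE : s \in E by apply: (mem_expos (i := i) (GM _ gG).2); rewrite -pf.
have s0E : s0 \in E by apply: (mem_expos (f := f1)) s0f; exact: mem_head.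
have := le_trans (dotv_sphere_le s w1) (hC _ sE).
have := le_trans (dotv_sphere_le s0 w1) (hC _ s0E).
rewrite !ler_norml => /andP[? ?] /andP[? ?].
by have := dot_le b; move: X10 hN wb0; lra.
Unshelve. all: by end_near. Qed.

End Lift.

(** * The local-global equivalence *)

Theorem mainTheorem9 (R : realType) (n K : nat)
    (M : lvec R n K -> Prop) (HM : is_submodule M)
    (a : 'I_K -> expo n) (I J : {set 'I_K}) :
  (exists f : lvec R n K,
      [/\ M f, (forall i, Apos (f i)) &
          forall v : 'rV[R]_n, v != 0 ->
            (Ov a v :|: J) :&: Mv v I f != set0])
  <->
  ((* LocR *)
   (forall r : 'rV[R]_n, (forall j, 0 < r 0 j) ->
      exists fr : lvec R n K, M fr /\ forall i, 0 < leval r (fr i))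
   /\
   (* LocInf *)
   (forall v : 'rV[R]_n, v != 0 ->
      exists fv : lvec R n K,
        [/\ M fv, (forall i, Apos (inv_vec v fv i)) &
            forall w : 'rV[R]_n, w != 0 ->
              (Ov a w :|: (Ov a v :|: J)) :&: Mv w (Mv v I fv) (inv_vec v fv)
                != set0])).
Proof.
split=> [[f [Mf fpos hf]]|[locr locinf]].
  (* Forward direction: the global vector serves at every point and in every direction. *)
  have f_in v i : Apos (inv_vec v f i).
    have [fi0 fi] := fpos i; rewrite ffunE; apply/Apos_inv; split=> // b tb.
    by rewrite lt_neqAle fi andbT eq_sym mcoeff_neq0; case/vtopP: tb.
  have gf v : v != 0 -> good a I J f v by move=> v0; apply/goodP; split; last exact: hf.
  split=> [r r0|v v0].
    exists f; split=> // i; have [fi0 fi] := fpos i.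
    apply: psum_seq_gt0.
      move=> s _; rewrite mulr_ge0 //; apply: prodr_ge0 => j _.
      by rewrite exprz_ge0 // ltW.
    have [s sf] := msupp_ex fi0; exists s => //; rewrite mulr_gt0 //.
      by rewrite lt_neqAle fi andbT eq_sym mcoeff_neq0.
    by apply: prodr_gt0 => j _; rewrite exprz_gt0.
  exists f; split=> // w w0.
  (* For small positive [e] the perturbed direction is nonzero and refines [v], so [good_locinf]
     applies. *)
  have cv : v + e *: w @[e --> (0 : R)^'+] --> v.
    rewrite -[X in _ --> X]addr0 -[X in _ + X](scale0r w).
    apply: cvgD; first exact: cvg_cst.
    by apply: cvgZr_tmp; exact: cvg_within.
  have h1 := cv _ (near_refines v f).
  have h2 := cvgr_neq0 _ cv v0.
  near (0 : R)^'+ => e.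
  apply: (@good_locinf _ _ _ a I J f v w e) => //.
    by near: e; exact: h1.
  by apply: gf; near: e; exact: h2.
have locr' x : exists f, M f /\ forall i, 0 < expeval x (f i).
  have [|f [Mf hf]] := locr (\row_j expR (x 0 j)).
    by move=> j; rewrite mxE expR_gt0.
  by exists f; split=> // i; rewrite -leval_expR.
have [|f1 [Mf1 gf1]] := @glue_infinity R n K a I J M HM.
  move=> v v0; have [f [Mf f1 f2]] := locinf v v0; exists f; split=> //.
  exact: locinf_near_good.
have [h [Mh hpos hgood]] := positive_lift HM locr' Mf1 gf1.
by exists h; split=> // v v0; have /goodP[] := hgood v v0.
Unshelve. all: by end_near. Qed.
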